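(* Let $\Gamma:[0,T]\rightrightarrows\mathbb R^d$ be a closed convex-valued solid mapping such that $\vec\Gamma$ is solid (i.e. $\mathrm{int}\,\vec\Gamma_t\neq\emptyset$ for $t\in(0,T]$). Then $$\Gamma_t=\mathrm{cl}\{y_t\mid y\in D(\Gamma)\}\quad\text{for all }t$$ if and only if $\Gamma$ is right-isc. In this case, $\vec\Gamma$ is left-isc and $$\vec\Gamma_t=\mathrm{cl}\{y_{t-}\mid y\in D(\Gamma)\}\quad\text{for all }t.$$
   Context: $T\in(0,+\infty]$. $D$ is the space of $\mathbb R^d$-valued càdlàg functions on $[0,T]$, $D(\Gamma)=\{y\in D\mid y_t\in\Gamma_t\ \forall t\}$, $y_-$ is the left-continuous version of $y$ and $y_{0-}:=0$. A convex-valued mapping $\Gamma$ is solid if $\mathrm{int}\,\Gamma_t\ne\emptyset$ for all $t$. Let $\tau_r$ (resp. $\tau_l$) be the topology on $\mathbb R$ generated by the intervals $[s,t)$ (resp. $(s,t]$), $s<t$. $\Gamma$ is right-inner semicontinuous (right-isc) if $\Gamma^{-1}(O)=\{t\mid\Gamma_t\cap O\neq\emptyset\}$ is $\tau_r$-open for every open $O\subseteq\mathbb R^d$; left-isc is defined analogously with $\tau_l$. $\vec\Gamma_0:=\{0\}$ and, for $t>0$, $\vec\Gamma_t:=\liminf_{s\upuparrows t}\Gamma_s$, the Painlevé–Kuratowski inner limit taken along strictly increasing sequences $s\to t$. *)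

(* Defs.v *)
From HB Require Import structures.
From mathcomp Require Import all_boot all_order all_algebra.
From mathcomp Require Import all_classical all_reals all_analysis.
Set Implicit Arguments.
Unset Strict Implicit.
Unset Printing Implicit Defensive.
Import Order.TTheory GRing.Theory Num.Theory numFieldNormedType.Exports.
Local Open Scope classical_set_scope.
Local Open Scope ring_scope.

(* The horizon T may be +oo, so times are extended reals and the time set is the
   interval [0, T] of \bar R, which contains +oo when T = +oo.  Set-valued
   mappings and paths are total functions on \bar R of which only the values on
   [0, T] matter. *)
Definition times (R : realType) (T : \bar R) : set (\bar R) :=
  [set t | (0 <= t)%E /\ (t <= T)%E].

Definition is_topology (X : Type) (O : set (set X)) : Prop :=
  [/\ O set0, O setT,
      (forall A B, O A -> O B -> O (A `&` B)) &
      (forall F : set (set X), F `<=` O -> O (\bigcup_(A in F) A))].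

(* The sets [s, +oo] are the half-open intervals "[s, t) with t beyond +oo":
   the trace of tau_r on the real line is the topology generated by the real
   intervals [s, t), and +oo is an isolated point of tau_r, just as a finite T
   is in the trace of tau_r on [0, T]. *)
Definition tau_r (R : realType) : set (set (\bar R)) :=
  smallest (@is_topology (\bar R))
    ([set A | exists s t : \bar R,
        (s < t)%E /\ A = [set u | (s <= u)%E /\ (u < t)%E]] `|`
     [set A | exists s : \bar R, A = [set u | (s <= u)%E]]).

Definition tau_l (R : realType) : set (set (\bar R)) :=
  smallest (@is_topology (\bar R))
    ([set A | exists s t : \bar R,
        (s < t)%E /\ A = [set u | (s < u)%E /\ (u <= t)%E]] `|`
     [set A | exists t : \bar R, A = [set u | (u <= t)%E]]).

Definition relatively_open (X : Type) (O : set (set X)) (I A : set X) : Prop :=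
  exists2 U, O U & A = I `&` U.

Section SetValued.
Context {R : realType} {d : nat}.
Implicit Types (T : \bar R) (Gamma : \bar R -> set 'rV[R]_d).

Definition preimage_sv T Gamma (O : set 'rV[R]_d) : set (\bar R) :=
  [set t | times T t /\ Gamma t `&` O !=set0].

Definition right_isc T Gamma : Prop :=
  forall O, open O -> relatively_open (@tau_r R) (times T) (preimage_sv T Gamma O).

Definition left_isc T Gamma : Prop :=
  forall O, open O -> relatively_open (@tau_l R) (times T) (preimage_sv T Gamma O).

(* Painleve-Kuratowski inner limit of a sequence of sets *)
Definition seq_inner_limit (C : nat -> set 'rV[R]_d) : set 'rV[R]_d :=
  [set x | exists2 u : nat -> 'rV[R]_d,
     \forall n \near \oo, C n (u n) & u @ \oo --> x].

Definition left_inner_limit T Gamma (t : \bar R) : set 'rV[R]_d :=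
  [set x | forall s : nat -> \bar R,
     (forall n, times T (s n)) -> (forall n, (s n < s n.+1)%E) ->
     s @ \oo --> t ->
     seq_inner_limit (fun n => Gamma (s n)) x].

Definition vec T Gamma (t : \bar R) : set 'rV[R]_d :=
  if t == 0%E then [set 0] else left_inner_limit T Gamma t.

Definition left_nbhs (t : \bar R) : set_system (\bar R) :=
  within [set s | (s < t)%E] (nbhs t).

Definition right_nbhs (t : \bar R) : set_system (\bar R) :=
  within [set s | (t < s)%E] (nbhs t).

Definition cadlag T (y : \bar R -> 'rV[R]_d) : Prop :=
  (forall t, (0 <= t)%E -> (t < T)%E -> y @ right_nbhs t --> y t) /\
  (forall t, (0 < t)%E -> (t <= T)%E -> exists l : 'rV[R]_d, y @ left_nbhs t --> l).

Definition left_version (y : \bar R -> 'rV[R]_d) (t : \bar R) : 'rV[R]_d :=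
  if t == 0%E then 0 else lim (y @ left_nbhs t).

Definition cadlag_selections T Gamma : set (\bar R -> 'rV[R]_d) :=
  [set y | cadlag T y /\ forall t, times T t -> Gamma t (y t)].

End SetValued.

(* Main.v *)
Require Import Defs.
From HB Require Import structures.
From mathcomp Require Import all_boot all_order all_algebra.
From mathcomp Require Import all_classical all_reals all_analysis.
From mathcomp Require Import ring lra.
Set Implicit Arguments.
Unset Strict Implicit.
Unset Printing Implicit Defensive.
Import Order.TTheory GRing.Theory Num.Theory numFieldNormedType.Exports.
Local Open Scope classical_set_scope.
Local Open Scope ring_scope.

(** The selections come from one fact of finite-dimensional convexity
    ([interior_near_mem]): if the convex sets [C s] eventually meet every open
    set that meets [K], then every interior point of [K] eventually belongs to
    [C s].  Right inner semicontinuity feeds this fact with [K = Gamma t] and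
    the right neighbourhoods of [t]; the definition of the inner limit feeds it
    with [K = vec T Gamma t] and the left neighbourhoods of [t].  Hence an
    interior point [x] of [Gamma t], [t < T], is a constant selection on some
    [[t, c)], and an interior point of [vec T Gamma t] is a constant selection
    on some [[a, t)].

    Since constant pieces start at every time before [T] and end at every
    positive time, a least upper bound argument on [[0, T]] glues constants
    into a piecewise constant cadlag selection ([selection_below_horizon]);
    solidity of the left limits is what lets the construction pass through the
    supremum.  Overwriting a cadlag selection by a constant on one more
    interval then prescribes its value at [t], or its left limit at [t], to be
    any interior point.  A convex set with nonempty interior lies in the
    closure of its interior, so these selections are dense in [Gamma t] and in
    [vec T Gamma t].

    Conversely, right continuity of selections that are dense in [Gamma t]
    gives right inner semicontinuity.  Left inner semicontinuity of [vec]
    is read off the constant pieces: a piece [x] on [[a, t)] lies in [vec] at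
    all positive times of [(a, t]]. *)

(** * Convex sets in finite dimension *)

Section Convexity.
Context {R : realType} {d : nat}.
Implicit Types (C K : set 'rV[R]_d) (x y : 'rV[R]_d).

Lemma convex_setE C x y (l : R) : convex_set C -> 0 <= l <= 1 ->
  C x -> C y -> C (l *: x + (1 - l) *: y).
Proof.
move=> cC l01 Cx Cy.
have itv_l : Itv.spec (@Itv.num_sem R) (Itv.Real `[0%Z, 1%Z]) l.
  by rewrite /= /Itv.num_sem /= in_itv/= l01 andbT realE; case/andP: l01 => ->.
by have := cC x y (Itv.mk itv_l); rewrite !inE; apply.
Qed.

(** Coordinates are corrected to those of [x] one at a time: two points of [C]
    that agree with [x] below coordinate [k], lie on opposite sides of [x] in
    coordinate [k], and have the same strict sign pattern beyond it have a
    convex combination that agrees with [x] also in coordinate [k] and keeps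
    the remaining signs.  This replaces an appeal to simplices or
    separation. *)
Lemma orthant_mem C x (v : {ffun 'I_d -> bool} -> 'rV[R]_d) : convex_set C ->
  (forall sg, C (v sg)) ->
  (forall (sg : {ffun 'I_d -> bool}) i,
     0 < (-1) ^+ sg i * (v sg 0 i - x 0 i)) ->
  C x.
Proof.
move=> cC Cv signv.
have step k : (k <= d)%N -> forall sg : {ffun 'I_d -> bool}, exists w, [/\ C w,
    (forall i : 'I_d, (i < k)%N -> w 0 i = x 0 i) &
    (forall i : 'I_d, (k <= i)%N -> 0 < (-1) ^+ sg i * (w 0 i - x 0 i))].
  elim: k => [_ sg|k IH kd sg]; first by exists (v sg); split.
  have {IH}IH := IH (ltnW kd).
  pose set_sg b := [ffun i : 'I_d => if i == k :> nat then b else sg i].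
  have [w0 [Cw0 w0x w0s]] := IH (set_sg false).
  have [w1 [Cw1 w1x w1s]] := IH (set_sg true).
  pose k' := Ordinal kd.
  have := w0s k' (leqnn k); have := w1s k' (leqnn k).
  rewrite !ffunE eqxx expr1 expr0 mulN1r mul1r opprB.
  set a := w0 _ _ - _; set b := _ - w1 _ _ => b0 a0.
  have ab0 : a + b != 0 by rewrite gt_eqF// addr_gt0.
  (* the weight that cancels coordinate k: l * a - (1 - l) * b = 0 *)
  pose l := b / (a + b).
  have l0 : 0 < l by rewrite divr_gt0// addr_gt0.
  have l1 : 0 < 1 - l.
    have -> : 1 - l = a / (a + b).
      by apply: (mulIf ab0); rewrite mulrBl !divfK// mul1r addrK.
    by rewrite divr_gt0// addr_gt0.
  exists (l *: w0 + (1 - l) *: w1); split.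
  - by apply: convex_setE => //; rewrite (ltW l0) -subr_ge0 ltW.
  - move=> i; rewrite !mxE ltnS leq_eqVlt => /predU1P[ik|ik].
      have -> : i = k' by exact/val_inj.
      have -> : w0 0 k' = x 0 k' + a by rewrite /a addrC subrK.
      have -> : w1 0 k' = x 0 k' - b by rewrite /b opprB addrC subrK.
      by rewrite /l; field.
    by rewrite w0x// w1x//; ring.
  - move=> i ki; have := w0s i (ltnW ki); have := w1s i (ltnW ki).
    rewrite !ffunE (gtn_eqF ki) => w1i w0i.
    rewrite !mxE (_ : _ * _ = l * ((-1) ^+ sg i * (w0 0 i - x 0 i)) +
      (1 - l) * ((-1) ^+ sg i * (w1 0 i - x 0 i))); last by ring.
    by rewrite addr_gt0// mulr_gt0.
have [w [Cw wx _]] := step d (leqnn d) [ffun=> false].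
by rewrite (_ : x = w)//; apply/rowP => i; rewrite wx.
Qed.

(** The vertices of a small cube around [x] lie in [K].  Only finitely many of
    them have to be approximated, so the filter provides all approximations at
    once, and an error of half an edge cannot change a sign relative
    to [x]. *)
Lemma interior_near_mem {S : Type} (F : set_system S) {FF : Filter F}
    (C : S -> set 'rV[R]_d) K x :
  (\forall s \near F, convex_set (C s)) ->
  (forall O, open O -> K `&` O !=set0 -> \forall s \near F, C s `&` O !=set0) ->
  K° x -> \forall s \near F, C s x.
Proof.
move=> cC KC; rewrite /interior /= => /nbhs_ballP[e /= e0 eK].
pose p (sg : {ffun 'I_d -> bool}) : 'rV[R]_d :=
  \row_i (x 0 i + (-1) ^+ sg i * (e / 2)).
have e20 : 0 < e / 2 by rewrite divr_gt0.
have Kp sg : K (p sg).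
  apply: eK; split=> // i j; rewrite -ball_normE /ball_/= mxE (ord1 i).
  rewrite opprD addrA subrr sub0r normrN normrM normrX normrN1 expr1n mul1r.
  by rewrite gtr0_norm//; lra.
have : \forall s \near F, forall sg, C s `&` ball (p sg) (e / 2) !=set0.
  apply: filter_forall => sg; apply: KC; first exact: ball_open.
  by exists (p sg); split => //; exact: ballxx.
move: cC; apply: filterS2 => s cC /(_ _)/cid-/all_sig[v vP].
apply: (@orthant_mem _ _ v) => // [sg|sg i]; first by have [] := vP sg.
have [_ [_ /(_ 0 i)]] := vP sg.
rewrite -ball_normE /ball_/= mxE; case: (sg i).
  by rewrite expr1 ltr_norml => /andP[? ?]; lra.
by rewrite expr0 ltr_norml => /andP[? ?]; lra.
Qed.

(** Moving a point [x] of [K] slightly towards the centre [z] of a ball of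
    radius [r] inside [K] produces, at the ratio [l], the centre of a ball of
    radius [l * r] inside [K]. *)
Lemma open_meets_interior K O : convex_set K -> K° !=set0 -> open O ->
  K `&` O !=set0 -> K° `&` O !=set0.
Proof.
move=> cK [z]; rewrite /interior /= => /nbhs_ballP[r /= r0 rK] oO [x [Kx Ox]].
have cvgx : (fun l : R => l *: z + (1 - l) *: x) @ 0^'+ --> x.
  rewrite -[X in _ --> X](_ : 0 *: z + (1 - 0) *: x = x); last first.
    by rewrite scale0r add0r subr0 scale1r.
  apply: cvg_at_right_filter; apply: cvgD.
    by apply: cvgZr_tmp; exact: cvg_id.
  by apply: cvgZr_tmp; apply: cvgB; [exact: cvg_cst|exact: cvg_id].
have := cvgx _ (open_nbhs_nbhs (conj oO Ox)); rewrite nbhs_filterE => nearO.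
have [l [[Ol l0] l1]] : exists l : R,
    (O (l *: z + (1 - l) *: x) /\ 0 < l) /\ l < 1.
  near (0 : R)^'+ => l; exists l; split; first split.
  - by near: l.
  - by near: l; exact: nbhs_right_gt.
  - by near: l; exact: nbhs_right_lt.
exists (l *: z + (1 - l) *: x); split => //.
apply/nbhs_ballP; exists (l * r); first exact: mulr_gt0.
move=> y; rewrite -ball_normE /ball_/= => yr.
(* y is the image of a point of the ball around z under the contraction with
   centre x and ratio l *)
have -> : y = l *: (z - l^-1 *: (l *: z + (1 - l) *: x - y)) + (1 - l) *: x.
  by rewrite scalerBr scalerA divff ?gt_eqF// scale1r opprB addrAC addrC subrK.
apply: convex_setE => //; first by rewrite !ltW.
apply: rK; rewrite -ball_normE /ball_/= subKr normrZ gtr0_norm ?invr_gt0//.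
by rewrite ltr_pdivrMl.
Unshelve. all: by end_near. Qed.

Lemma convex_sub_closure_interior K : convex_set K -> K° !=set0 ->
  K `<=` closure K°.
Proof.
move=> cK K0 x Kx B; rewrite nbhsE => -[U [oU Ux] UB].
have [y [Ky Oy]] := open_meets_interior cK K0 oU (ex_intro _ x (conj Kx Ux)).
by exists y; split => //; exact: UB.
Qed.

End Convexity.

(** * One-sided neighbourhoods in the extended real line *)

Section OneSidedNeighbourhoods.
Context {R : realType}.
Implicit Types (s t a c : \bar R) (A : set (\bar R)).
Local Open Scope ereal_scope.

Global Instance left_nbhs_filter t : Filter (left_nbhs t).
Proof. exact: within_filter. Qed.

Global Instance right_nbhs_filter t : Filter (right_nbhs t).
Proof. exact: within_filter. Qed.

Lemma near_left_gt a t : a < t -> \forall s \near left_nbhs t, a < s < t.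
Proof.
move=> at_; rewrite /left_nbhs near_withinE.
by apply: filterS (open_ereal_gt' at_) => s /= as_ st; rewrite as_.
Qed.

Lemma near_right_lt t c : t < c -> \forall s \near right_nbhs t, t < s < c.
Proof.
move=> tc; rewrite /right_nbhs near_withinE.
by apply: filterS (open_ereal_lt' tc) => s /= sc ts; rewrite ts.
Qed.

Lemma left_nbhsP t A : -oo < t -> left_nbhs t A ->
  exists2 a, a < t & forall s, a < s < t -> A s.
Proof.
case: t => [r _|_|//]; rewrite /left_nbhs /within /nbhs /=.
- move=> [e /= e0 rA]; exists (r - e)%:E; first by rewrite lte_fin gtrBl.
  move=> [s| |] /andP[]//; rewrite !lte_fin => es sr.
  by apply: rA; rewrite /= ?lte_fin// ltr_norml; lra.
- move=> [M [_ MA]]; exists M%:E; first exact: ltry.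
  by move=> s /andP[Ms sy]; exact: MA.
Qed.

Lemma right_nbhsP t A : t < +oo -> right_nbhs t A ->
  exists2 c, t < c & forall s, t < s < c -> A s.
Proof.
case: t => [r _|//|_]; rewrite /right_nbhs /within /nbhs /=.
- move=> [e /= e0 rA]; exists (r + e)%:E; first by rewrite lte_fin ltrDl.
  move=> [s| |] /andP[]//; rewrite !lte_fin => rs se.
  by apply: rA; rewrite /= ?lte_fin// ltr_norml; lra.
- move=> [M [_ MA]]; exists M%:E; first exact: ltNyr.
  by move=> s /andP[Ms sy]; exact: MA.
Qed.

Lemma cvg_from_below t : -oo < t ->
  exists2 b : nat -> \bar R, (forall n, b n < t) & b @ \oo --> t.
Proof.
case: t => [r _|_|//].
- exists (fun n => (r - n.+1%:R^-1)%:E) => [n|].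
    by rewrite lte_fin gtrBl invr_gt0 ltr0n.
  apply: cvg_EFin; first exact: nearW.
  rewrite -[X in _ --> X]subr0; apply: cvgB; first exact: cvg_cst.
  exact: cvg_harmonic.
- exists (fun n => n%:R%:E) => [n|]; first exact: ltry.
  apply/cvgeryP; exact: cvgr_idn.
Qed.

Lemma left_nbhs_proper t : -oo < t -> ProperFilter (left_nbhs t).
Proof.
move=> t0; apply: Build_ProperFilter_ex => A /(left_nbhsP t0)[a at_ aA].
have [b bt /(_ _ (open_ereal_gt' at_))] :=
  cvg_from_below t0.
move=> [n _ /(_ n (leqnn n)) /= an].
by exists (b n); apply: aA; rewrite an bt.
Qed.

(** A strictly increasing sequence never reaches its limit, so the inner limit
    along such sequences only sees the left neighbourhoods of [t]. *)
Lemma increasing_cvg_left (s : nat -> \bar R) t : (forall n, s n < s n.+1) ->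
  s @ \oo --> t -> s @ \oo --> left_nbhs t.
Proof.
move=> s_incr st.
have slt n : s n < t.
  rewrite (lt_le_trans (s_incr n))//; apply: (cvge_ge _ st).
  have s_mono : nondecreasing_seq s.
    by apply/nondecreasing_seqP => k; exact: ltW.
  by exists n.+1 => // m /s_mono.
move=> A At.
have stA : \forall n \near \oo, s n < t -> A (s n) := st _ At.
by apply: filterS stA => n; apply.
Qed.

(** Each term is chosen in [B] beyond both its predecessor, for strict growth,
    and a fixed sequence tending to [t] from below, for convergence. *)
Lemma frequently_left_seq (B : set (\bar R)) t : -oo < t ->
  (forall a, a < t -> exists2 s, B s & a < s < t) ->
  exists s : nat -> \bar R,
    [/\ forall n, B (s n), forall n, s n < s n.+1 & s @ \oo --> t].
Proof.
move=> t0 Bt; have [b bt cvgb] := cvg_from_below t0.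
have /choice[g gP] : forall a, exists s, a < t -> B s /\ a < s < t.
  move=> a; have [/Bt[s Bs ast]|ta] := ltP a t; first by exists s.
  by exists a.
pose s := fix s n := if n is m.+1 then g (maxe (s m) (b m)) else g (b 0%N).
have sP n : B (s n) /\ s n < t.
  elim: n => [|n [_ IH]] /=; first by have [? /andP[_]] := gP _ (bt 0%N).
  have /gP[? /andP[_]]// : maxe (s n) (b n) < t by rewrite gt_max IH bt.
have sS n : maxe (s n) (b n) < s n.+1.
  have /gP[_ /andP[]]// : maxe (s n) (b n) < t by rewrite gt_max bt (sP n).2.
exists s; split => [n|n|]; first exact: (sP n).1.
  by have := sS n; rewrite gt_max => /andP[].
rewrite -(cvg_shiftS s); apply: (squeeze_cvge _ cvgb (cvg_cst t)).
apply: nearW => n; have := sS n; rewrite gt_max => /andP[_ /ltW ->].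
by rewrite ltW// (sP n.+1).2.
Qed.

End OneSidedNeighbourhoods.

(** * Inner limits from the left *)

Section InnerLimits.
Context {R : realType} {d : nat}.
Implicit Types (T s t : \bar R) (Gamma : \bar R -> set 'rV[R]_d) (x : 'rV[R]_d).

(** The approximating sequence takes in each [C n] a point whose distance to
    [x] is within [1 / (n + 1)] of the infimum, since the infimum need not be
    attained. *)
Lemma seq_inner_limitP (C : nat -> set 'rV[R]_d) x :
  seq_inner_limit C x <->
  forall e : R, 0 < e -> \forall n \near \oo, C n `&` ball x e !=set0.
Proof.
split=> [[u Cu ux] e e0|Cx].
  by apply: filterS2 Cu (cvg_ball ux e0) => n Cn un; exists (u n).
pose dist n := [set `|x - v| | v in C n].
have dist_lb n : has_lbound (dist n) by exists 0 => _ [v _ <-].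
have /choice[u uP] : forall n, exists v,
    C n !=set0 -> C n v /\ `|x - v| < inf (dist n) + n.+1%:R^-1.
  move=> n; have [[w Cw]|Cn0] := pselect (C n !=set0); last by exists x => /Cn0.
  have [||_ [v Cv <-] xv] := @inf_adherent _ (dist n) n.+1%:R^-1.
  - by rewrite invr_gt0.
  - by split=> //; exists `|x - w|, w.
  - by exists v.
exists u.
  by apply: filterS (Cx 1 ltr01) => n [v [Cv _]]; apply uP; exists v.
apply/cvgrPdist_lt => e e0; have e20 : 0 < e / 2 by rewrite divr_gt0.
near=> n.
have [v [Cv]] : C n `&` ball x (e / 2) !=set0.
  by near: n; exact: Cx.
rewrite -ball_normE /ball_/= => xv.
have [_ xu] := uP n (ex_intro _ v Cv).
have infv : inf (dist n) <= `|x - v| by apply: ge_inf => //; exists v.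
have n_e : n.+1%:R^-1 < e / 2.
  by near: n; exact: near_infty_natSinv_lt (PosNum e20).
apply: lt_trans xu _; rewrite [ltRHS]splitr ltrD//.
exact: le_lt_trans infv xv.
Unshelve. all: by end_near. Qed.

Lemma vec0 T Gamma : vec T Gamma 0%E = [set 0].
Proof. by rewrite /vec eqxx. Qed.

Lemma near_left_times T t : (0 < t)%E -> (t <= T)%E ->
  \forall s \near left_nbhs t, times T s.
Proof.
move=> t0 tT; apply: filterS (near_left_gt t0) => s /andP[s0 st].
by split; rewrite ltW// (lt_le_trans st).
Qed.

(** This trades the quantification over strictly increasing sequences for the
    filter of left neighbourhoods, from which closedness and convexity of the
    inner limit are immediate.  If the filter condition fails for some [e], the
    bad times accumulate at [t] from the left and so carry a strictly
    increasing sequence that contradicts membership in the inner limit. *)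
Lemma vecP T Gamma t x : (0 < t)%E -> (t <= T)%E ->
  vec T Gamma t x <->
  forall e : R, 0 < e ->
    \forall s \near left_nbhs t, Gamma s `&` ball x e !=set0.
Proof.
move=> t0 tT; rewrite /vec gt_eqF//.
split=> [Gx e e0|Gx s _ s_incr st]; last first.
  apply/seq_inner_limitP => e e0.
  exact: (increasing_cvg_left s_incr st (Gx e e0)).
apply: contrapT => notnear.
pose B := [set s | times T s /\ ~ (Gamma s `&` ball x e !=set0)].
have [a at_|s [Bs s_incr st]] := @frequently_left_seq _ B t (lt_trans ltNy0 t0).
  apply: contrapT => noB; apply: notnear.
  have := near_left_times t0 tT; have := near_left_gt at_.
  apply: filterS2 => s ast Ts; apply: contrapT => Gs; apply: noB.
  by exists s.
have /seq_inner_limitP/(_ e e0)[n _ /(_ n (leqnn n)) Gn] :=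
  Gx s (fun n => (Bs n).1) s_incr st.
exact: (Bs n).2.
Qed.

Lemma vec_meets_open T Gamma t O : (0 < t)%E -> (t <= T)%E -> open O ->
  vec T Gamma t `&` O !=set0 ->
  \forall s \near left_nbhs t, Gamma s `&` O !=set0.
Proof.
move=> t0 tT oO [x [Gx Ox]].
have /nbhs_ballP[e /= e0 eO] := open_nbhs_nbhs (conj oO Ox).
have /(vecP _ _ t0 tT)/(_ e e0) := Gx.
by apply: filterS => s [y [Gy xy]]; exists y; split => //; exact: eO.
Qed.

Lemma closed_vec T Gamma t : times T t -> closed (vec T Gamma t).
Proof.
move=> [t0 tT]; have [<-|tn0] := eqVneq 0%E t.
  rewrite vec0; apply: accessible_closed_set1.
  exact/hausdorff_accessible/norm_hausdorff.
have {}t0 : (0 < t)%E by rewrite lt_neqAle tn0.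
move=> x xcl; apply/vecP => // e e0; have e20 : 0 < e / 2 by rewrite divr_gt0.
have [y [/(vecP _ _ t0 tT)/(_ _ e20) + xy]] := xcl _ (nbhsx_ballx x _ e20).
apply: filterS => s [z [Gz yz]]; exists z; split => //.
exact: ball_split xy yz.
Qed.

Lemma convex_vec T Gamma t : (0 < t)%E -> (t <= T)%E ->
  (forall s, times T s -> convex_set (Gamma s)) -> convex_set (vec T Gamma t).
Proof.
move=> t0 tT cG x y l; rewrite !inE.
move=> /(vecP _ _ t0 tT) xG /(vecP _ _ t0 tT) yG.
apply/vecP => // e e0; near=> s.
have [x' [Gx' xx']] : Gamma s `&` ball x e !=set0 by near: s; exact: xG.
have [y' [Gy' yy']] : Gamma s `&` ball y e !=set0 by near: s; exact: yG.
exists (conv l (x' : convex_lmodType _) y'); split.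
  have /cG : times T s by near: s; exact: near_left_times.
  by move=> /(_ x' y' l); rewrite !inE; apply.
move: xx' yy'; rewrite -!ball_normE /ball_/= => xx' yy'.
have -> :
  conv l (x : convex_lmodType _) y - conv l (x' : convex_lmodType _) y' =
    l%:num *: (x - x') + (1 - l%:num) *: (y - y').
  by rewrite !scalerBr addrACA -opprD.
apply: le_lt_trans (ler_normD _ _) _.
have l0 : 0 <= l%:num by [].
have l1 : l%:num <= 1 by [].
rewrite !normrZ ger0_norm// ger0_norm ?subr_ge0//.
have m_lt : Num.max `|x - x'| `|y - y'| < e by rewrite gt_max xx'.
apply: le_lt_trans m_lt; set m := Num.max _ _.
have -> : m = l%:num * m + (1 - l%:num) * m by ring.
by rewrite lerD// ler_wpM2l ?subr_ge0// /m le_max lexx ?orbT.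
Unshelve. all: by end_near. Qed.

End InnerLimits.

(** * Topologies generated by half-open intervals *)

Section OneSidedTopologies.
Context {R : realType}.
Implicit Types (T t : \bar R).

Lemma relatively_open_local (X : Type) (G : set (set X)) (I A : set X) :
  A `<=` I ->
  (forall x, A x -> exists2 U, G U /\ U x & I `&` U `<=` A) ->
  relatively_open (smallest (@is_topology X) G) I A.
Proof.
move=> AI loc; pose F := [set U | G U /\ I `&` U `<=` A].
exists (\bigcup_(U in F) U).
  move=> O [[_ _ _ Ocup] GO]; apply: Ocup => U [GU _]; exact: GO.
apply/seteqP; split=> [x Ax|x [Ix [U [_ IU] Ux]]]; last exact: IU.
split; first exact: AI.
by have [U [GU Ux] IU] := loc x Ax; exists U.
Qed.

(** The sets that are right neighbourhoods of each of their points form a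
    topology containing the generators, hence containing [tau_r].  At [+oo]
    the condition is void, in accordance with [+oo] being isolated. *)
Lemma tau_r_right_nbhs U t : @tau_r R U -> U t -> right_nbhs t U.
Proof.
pose O := [set V : set (\bar R) | forall s, V s -> right_nbhs s V].
suff : @tau_r R `<=` O by move=> /[apply]; apply.
move=> V; apply; split; first split.
- by [].
- by move=> s _; exact: filterT.
- by move=> A B OA OB s [/OA + /OB]; exact: filterI.
- move=> F FO s [A FA As]; apply: filterS (FO A FA s As) => r Ar.
  by exists A.
- move=> W [[a [b [ab ->]]]|[a ->]] s.
    move=> /= [as_ sb].
    apply: filterS (near_right_lt sb) => r /andP[sr rb].
    by split => //; exact: le_trans as_ (ltW sr).
  move=> /= as_; apply: filterS (@withinT _ (nbhs s) [set r | (s < r)%E] _).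
  by move=> r sr; exact: le_trans as_ (ltW sr).
Qed.

End OneSidedTopologies.

(** * Gluing cadlag functions *)

Section Gluing.
Context {R : realType} {d : nat}.
Implicit Types (T t a : \bar R) (y z : \bar R -> 'rV[R]_d).

Definition glue a y z : \bar R -> 'rV[R]_d :=
  fun s => if (s < a)%E then y s else z s.

Lemma cvg_glue_left a y z t (l : 'rV[R]_d) :
  (if (t <= a)%E then y else z) @ left_nbhs t --> l ->
  glue a y z @ left_nbhs t --> l.
Proof.
apply: cvg_trans; apply: near_eq_cvg; rewrite /glue.
case: (leP t a) => [ta|at_].
  rewrite /left_nbhs near_withinE; apply: nearW => s /= st.
  by rewrite (lt_le_trans st ta).
by apply: filterS (near_left_gt at_) => s /andP[as_ _]; rewrite ltNge ltW.
Qed.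

Lemma cvg_glue_right a y z t (l : 'rV[R]_d) :
  (if (t < a)%E then y else z) @ right_nbhs t --> l ->
  glue a y z @ right_nbhs t --> l.
Proof.
apply: cvg_trans; apply: near_eq_cvg; rewrite /glue.
case: (ltP t a) => [ta|at_].
  by apply: filterS (near_right_lt ta) => s /andP[_ ->].
rewrite /right_nbhs near_withinE; apply: nearW => s /= ts.
by rewrite ltNge (le_trans at_ (ltW ts)).
Qed.

(** The half-open convention, with the second function taken from [a] on, makes
    a jump at [a] harmless: the left limit there is that of [y] and the right
    limit is the value of [z]. *)
Lemma cadlag_glue T a y z : cadlag T y -> cadlag T z -> cadlag T (glue a y z).
Proof.
move=> [yr yl] [zr zl]; split=> t t0 tT.
  apply: cvg_glue_right; rewrite /glue.
  by case: ifP => _; [exact: yr|exact: zr].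
have [l yll] := yl t t0 tT; have [m zlm] := zl t t0 tT.
exists (if (t <= a)%E then l else m).
by apply: cvg_glue_left; case: ifP.
Qed.

Lemma cadlag_cst T (x : 'rV[R]_d) : cadlag T (fun=> x).
Proof.
by split=> t _ _; [|exists x]; exact: cvg_cst.
Qed.

End Gluing.

(** * Construction of cadlag selections *)

Section Selections.
Context {R : realType} {d : nat} (T : \bar R) (Gamma : \bar R -> set 'rV[R]_d).
Context (T_gt0 : (0 < T)%E).
Context (Gamma_convex : forall t, times T t -> convex_set (Gamma t)).
Context (Gamma_right_isc : right_isc T Gamma).
Implicit Types (t s a c : \bar R) (x : 'rV[R]_d).

(** Right inner semicontinuity at [t], applied to the finitely many open sets
    that [interior_near_mem] uses, keeps the interior point [x] inside the
    values of [Gamma] right after [t]. *)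
Lemma constant_right_selection t x : (0 <= t)%E -> (t < T)%E -> (Gamma t)° x ->
  exists2 c, (t < c)%E & forall s, (t <= s < c)%E -> Gamma s x.
Proof.
move=> t0 tT Gx.
have near_x : \forall s \near right_nbhs t, Gamma s x.
  apply: (interior_near_mem (K := Gamma t)) => //.
    apply: filterS (near_right_lt tT) => s /andP[ts sT].
    by apply: Gamma_convex; split; rewrite ltW// (le_lt_trans t0).
  move=> O oO GO; have [U tauU UE] := Gamma_right_isc oO.
  have : preimage_sv T Gamma O t by split => //; split => //; exact: ltW.
  rewrite UE => -[_ Ut]; have := near_right_lt tT.
  have := tau_r_right_nbhs tauU Ut; apply: filterS2 => s Us /andP[ts sT].
  have : (times T `&` U) s.
    by split=> //; split; rewrite ltW// (le_lt_trans t0).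
  by rewrite -UE => -[].
have [c tc cx] := right_nbhsP (lt_le_trans tT (leey _)) near_x.
exists c => // s /andP[]; rewrite le_eqVlt => /predU1P[<- _|ts sc].
  exact: interior_subset.
by apply: cx; rewrite ts.
Qed.

Lemma constant_left_selection t x : (0 < t)%E -> (t <= T)%E ->
  (vec T Gamma t)° x ->
  exists2 a, (a < t)%E & forall s, (a <= s < t)%E -> Gamma s x.
Proof.
move=> t0 tT Gx; have tNy := lt_trans ltNy0 t0.
have near_x : \forall s \near left_nbhs t, Gamma s x.
  apply: (interior_near_mem (K := vec T Gamma t)) => //.
    by apply: filterS (near_left_times t0 tT) => s /Gamma_convex.
  by move=> O oO; exact: vec_meets_open.
have [a at_ ax] := left_nbhsP tNy near_x.
have PF := left_nbhs_proper tNy.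
have [b /andP[ab bt]] := filter_ex (near_left_gt at_).
by exists b => // s /andP[bs st]; apply: ax; rewrite st (lt_le_trans ab).
Qed.

Context (Gamma_solid : forall t, times T t -> (Gamma t)° !=set0).
Context (vec_solid : forall t : \bar R, (0 < t)%E -> (t <= T)%E ->
  (vec T Gamma t)° !=set0).

(** Let [t] be the supremum of the [b] such that some cadlag function selects
    from [Gamma] on [[0, b)].  A constant piece left of [t], taken in the
    interior of the inner limit, shows that [t] itself is such a [b]; if [t]
    were smaller than [T], a constant piece from [t] on would go beyond the
    supremum.  The functions are cadlag on the whole time set, with arbitrary
    values from [b] on, so that gluing is always allowed. *)
Lemma selection_below_horizon : exists2 y, cadlag T y &
  forall s, (0 <= s < T)%E -> Gamma s (y s).
Proof.
pose P b := exists2 y, cadlag T y & forall s, (0 <= s < b)%E -> Gamma s (y s).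
have P_down b c : (b <= c)%E -> P c -> P b.
  move=> bc [y cy Gy]; exists y => // s /andP[s0 sb].
  by apply: Gy; rewrite s0 (lt_le_trans sb).
pose S := [set b | [/\ (0 <= b)%E, (b <= T)%E & P b]].
pose t := ereal_sup S.
have S0 : S 0%E.
  split=> //; first exact: ltW.
  exists (fun=> 0); first exact: cadlag_cst.
  by move=> s /andP[s0 /(le_lt_trans s0)]; rewrite ltxx.
have t0 : (0 <= t)%E by exact: ereal_sup_ubound.
have tT : (t <= T)%E by apply: ge_ereal_sup => b [].
have Pt : P t.
  move: t0; rewrite le_eqVlt => /predU1P[<-|t0]; first by case: S0.
  have [x /(constant_left_selection t0 tT)[a at_ ax]] := vec_solid t0 tT.
  have [b [_ _ [y cy Gy]] ab] := ereal_sup_gt at_.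
  exists (glue b y (fun=> x)); first exact/cadlag_glue/cadlag_cst.
  move=> s /andP[s0 st]; rewrite /glue; case: ltP => [sb|bs].
    by apply: Gy; rewrite s0.
  by apply: ax; rewrite st (le_trans (ltW ab)).
suff : ~ (t < T)%E by move/negP; rewrite -leNgt => /P_down; exact.
move=> tltT; have [x Gx] := Gamma_solid (conj t0 tT).
have [c tc cx] := constant_right_selection t0 tltT Gx.
have : S (Order.min c T).
  split; first by rewrite le_min (ltW T_gt0) (le_trans t0 (ltW tc)).
    by rewrite ge_min lexx orbT.
  apply: (@P_down _ c); first by rewrite ge_min lexx.
  have [y cy Gy] := Pt.
  exists (glue t y (fun=> x)); first exact/cadlag_glue/cadlag_cst.
  move=> s /andP[s0 sc]; rewrite /glue; case: ltP => [st|ts].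
    by apply: Gy; rewrite s0.
  by apply: cx; rewrite ts.
move/ereal_sup_ubound; rewrite -/t leNgt lt_min tc tltT.
by [].
Qed.

Lemma cadlag_selection_glue_cst a c x y : cadlag_selections T Gamma y ->
  (forall s, (a <= s < c)%E -> Gamma s x) ->
  cadlag_selections T Gamma (glue a y (glue c (fun=> x) y)).
Proof.
move=> [cy Gy] Gx; split.
  by apply: cadlag_glue => //; apply: cadlag_glue => //; exact: cadlag_cst.
move=> t Tt; rewrite /glue; case: ltP => [_|at_]; first exact: Gy.
by case: ltP => [tc|_]; [apply: Gx; rewrite at_|exact: Gy].
Qed.

(** The value at [T] can be changed freely, since being cadlag imposes no
    condition from the right at [T]. *)
Lemma cadlag_selection_exists : cadlag_selections T Gamma !=set0.
Proof.
have [y cy Gy] := selection_below_horizon.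
have [x /interior_subset Gx] := Gamma_solid (conj (ltW T_gt0) (lexx T)).
exists (glue T y (fun=> x)); split; first exact/cadlag_glue/cadlag_cst.
move=> t [t0 tT]; rewrite /glue; case: ltP => [tltT|Tt].
  by apply: Gy; rewrite t0.
by rewrite (_ : t = T)//; apply/le_anti; rewrite tT.
Qed.

Lemma cadlag_selection_through t x : times T t -> (Gamma t)° x ->
  exists2 y, cadlag_selections T Gamma y & y t = x.
Proof.
move=> [t0 tT] Gx; have [y Gy] := cadlag_selection_exists.
have [tltT|Tt] := ltP t T.
  have [c tc cx] := constant_right_selection t0 tltT Gx.
  exists (glue t y (glue c (fun=> x) y)).
    exact: cadlag_selection_glue_cst.
  by rewrite /glue ltxx tc.
have {t0 Tt tT} tT : t = T by apply/le_anti; rewrite tT.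
exists (glue t y (fun=> x)); last by rewrite /glue ltxx.
case: Gy => cy Gy; split; first exact/cadlag_glue/cadlag_cst.
move=> s Ts; rewrite /glue; case: ltP => [_|ts]; first exact: Gy.
rewrite (_ : s = t); first exact: interior_subset.
by apply/le_anti; rewrite ts tT; case: Ts => _ ->.
Qed.

Lemma cadlag_selection_left_limit t x : (0 < t)%E -> (t <= T)%E ->
  (vec T Gamma t)° x ->
  exists2 y, cadlag_selections T Gamma y & y @ left_nbhs t --> x.
Proof.
move=> t0 tT Gx; have [y Gy] := cadlag_selection_exists.
have [a at_ ax] := constant_left_selection t0 tT Gx.
exists (glue a y (glue t (fun=> x) y)); first exact: cadlag_selection_glue_cst.
apply: cvg_glue_left; rewrite leNgt at_.
by apply: cvg_glue_left; rewrite lexx; exact: cvg_cst.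
Qed.

End Selections.

(** * Semicontinuity and the representation *)

Lemma left_limit_in_vec (R : realType) (d : nat) (T : \bar R)
    (Gamma : \bar R -> set 'rV[R]_d) y t x : (0 < t)%E -> (t <= T)%E ->
  cadlag_selections T Gamma y -> y @ left_nbhs t --> x -> vec T Gamma t x.
Proof.
move=> t0 tT [_ Gy] yx; apply/vecP => // e e0.
apply: filterS2 (near_left_times t0 tT) (cvg_ball yx e0) => s Ts xs.
by exists (y s); split => //; exact: Gy.
Qed.

(** A selection that takes a value in [O] at [t < T] keeps its values in [O] on
    some [[t, c)].  At [t = T] the generator [[T, +oo]] isolates [T] in the time
    set. *)
Lemma right_isc_of_selections (R : realType) (d : nat) (T : \bar R)
    (Gamma : \bar R -> set 'rV[R]_d) :
  (forall t, times T t ->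
     Gamma t `<=` closure [set y t | y in cadlag_selections T Gamma]) ->
  right_isc T Gamma.
Proof.
move=> dense O oO; apply: relatively_open_local => [t []//|t [Tt [x [Gx Ox]]]].
have [_ [[y [[yr yl] Gy] <-] Oy]] :=
  dense t Tt x Gx O (open_nbhs_nbhs (conj oO Ox)).
have [t0 tT] := Tt; have [tltT|TtE] := ltP t T.
  have /(right_nbhsP (lt_le_trans tltT (leey _)))[c tc cy] :=
    yr t t0 tltT O (open_nbhs_nbhs (conj oO Oy)).
  exists [set u | (t <= u)%E /\ (u < c)%E].
    by split; [left; exists t, c|split].
  move=> s [Ts [ts sc]]; split=> //; exists (y s); split; first exact: Gy.
  move: ts; rewrite le_eqVlt => /predU1P[<-//|ts].
  by apply: cy; rewrite ts.
exists [set u | (t <= u)%E]; first by split; [right; exists t|exact: lexx].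
move=> s [Ts ts]; have -> : s = t.
  by apply/le_anti/andP; split=> //; case: Ts => _ /le_trans; apply.
by split => //; exists (y t); split => //; exact: Gy.
Qed.

(** A point [x] of [O] in the interior of the inner limit at [t] is a constant
    selection on some [[a, t)], so it belongs to the inner limit at each
    positive time of [(a, t]].  At time [0] the generator [[-oo, 0]] isolates
    [0] in the time set. *)
Lemma left_isc_vec (R : realType) (d : nat) (T : \bar R)
    (Gamma : \bar R -> set 'rV[R]_d) :
  (forall t, times T t -> convex_set (Gamma t)) ->
  (forall t : \bar R, (0 < t)%E -> (t <= T)%E -> (vec T Gamma t)° !=set0) ->
  left_isc T (vec T Gamma).
Proof.
move=> cG solid O oO; apply: relatively_open_local => [t []//|t [Tt GO]].
have [t0 tT] := Tt; have [t0E|tn0] := eqVneq 0%E t.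
  exists [set u | (u <= t)%E]; first by split; [right; exists t|exact: lexx].
  move=> s [Ts st]; have -> : s = t.
    by apply/le_anti; rewrite st -t0E; case: Ts.
  by [].
have {}t0 : (0 < t)%E by rewrite lt_neqAle tn0.
have [x [Gx Ox]] :=
  open_meets_interior (convex_vec t0 tT cG) (solid t t0 tT) oO GO.
have [a at_ ax] := constant_left_selection cG t0 tT Gx.
pose b := Order.max 0%E a.
exists [set u | (b < u)%E /\ (u <= t)%E].
  split; last by split => //; rewrite gt_max t0.
  by left; exists b, t; split=> //; rewrite gt_max t0.
move=> s [Ts [+ st]]; rewrite gt_max => /andP[s0 as_]; split=> //.
exists x; split => //; apply/vecP => //; first exact: le_trans st tT.
move=> e e0; apply: filterS (near_left_gt as_) => r /andP[ar rs].
exists x; split; last exact: ballxx.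
by apply: ax; rewrite (ltW ar) (lt_le_trans rs).
Qed.

Theorem theorem17 (R : realType) (d : nat) (T : \bar R)
    (Gamma : \bar R -> set 'rV[R]_d)
    (T_gt0 : (0 < T)%E)
    (Gamma_closed : forall t, times T t -> closed (Gamma t))
    (Gamma_convex : forall t, times T t -> convex_set (Gamma t))
    (Gamma_solid : forall t, times T t -> (Gamma t)° !=set0)
    (vec_solid : forall t : \bar R, (0 < t)%E -> (t <= T)%E ->
       (vec T Gamma t)° !=set0) :
  ((forall t, times T t ->
      Gamma t = closure [set y t | y in cadlag_selections T Gamma]) <->
   right_isc T Gamma) /\
  (right_isc T Gamma ->
     left_isc T (vec T Gamma) /\
     (forall t, times T t ->
        vec T Gamma t =
        closure [set left_version y t | y in cadlag_selections T Gamma])).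
Proof.
split; [split=> [Gdense|Grisc t Tt]|move=> Grisc; split=> [|t Tt]].
- by apply: right_isc_of_selections => t Tt; rewrite -Gdense.
- apply/seteqP; split.
    apply: subset_trans (convex_sub_closure_interior (Gamma_convex t Tt)
      (Gamma_solid t Tt)) _.
    apply: closure_subset => x Gx.
    by have [y Gy yx] := cadlag_selection_through T_gt0 Gamma_convex Grisc
      Gamma_solid vec_solid Tt Gx; exists y.
  rewrite [X in _ `<=` X](closure_id _).1; last exact: Gamma_closed.
  by apply: closure_subset => _ [y [_ Gy] <-]; exact: Gy.
- exact: left_isc_vec.
- have [t0 tT] := Tt; have [<-|tn0] := eqVneq 0%E t.
    have [y Gy] := cadlag_selection_exists T_gt0 Gamma_convex Grisc
      Gamma_solid vec_solid.
    rewrite vec0 (_ : [set _ | _ in _] = [set 0]).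
      rewrite -(vec0 T Gamma); apply/closure_id/closed_vec.
      by split; [exact: lexx|exact: ltW].
    apply/seteqP; split=> [_ [z _ <-]|_ ->].
      by rewrite /left_version eqxx.
    by exists y => //; rewrite /left_version eqxx.
  have {tn0}t0 : (0 < t)%E by rewrite lt_neqAle tn0.
  have PF := left_nbhs_proper (lt_trans ltNy0 t0).
  have leftE y (l : 'rV[R]_d) : y @ left_nbhs t --> l -> left_version y t = l.
    move=> yl; rewrite /left_version gt_eqF//.
    exact: (cvg_lim (@norm_hausdorff _ _) yl).
  apply/seteqP; split.
    apply: subset_trans (convex_sub_closure_interior
      (convex_vec t0 tT Gamma_convex) (vec_solid t t0 tT)) _.
    apply: closure_subset => x Gx.
    have [y Gy yx] := cadlag_selection_left_limit T_gt0 Gamma_convex Grisc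
      Gamma_solid vec_solid t0 tT Gx.
    by exists y => //; exact: leftE.
  rewrite [X in _ `<=` X](closure_id _).1; last exact: closed_vec.
  apply: closure_subset => _ [y Gy <-].
  have [l yl] := Gy.1.2 t t0 tT; rewrite (leftE y l yl).
  exact: left_limit_in_vec yl.
Qed.
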